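(* A descent statistic $\mathrm{st}$ is shuffle-compatible if and only if for every $\mathrm{st}$-equivalence class $\alpha$ of compositions there exist constants $c^\alpha_{\beta,\gamma}\in\mathbb{Q}$ (indexed by $\mathrm{st}$-equivalence classes $\beta,\gamma$) such that $\Delta\mathbf{r}^{\mathrm{st}}_\alpha=\sum_{\beta,\gamma}c^\alpha_{\beta,\gamma}\mathbf{r}^{\mathrm{st}}_\beta\otimes\mathbf{r}^{\mathrm{st}}_\gamma$, i.e., the elements $\mathbf{r}^{\mathrm{st}}_\alpha$ span a subcoalgebra of $\mathbf{Sym}$. In this case the $c^\alpha_{\beta,\gamma}$ are the structure constants of $\mathcal{A}_{\mathrm{st}}$: writing $v_\alpha$ for the class of permutations with descent composition in $\alpha$, $v_\beta v_\gamma=\sum_\alpha c^\alpha_{\beta,\gamma}v_\alpha$.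
   Context: A permutation of length $n$ is a sequence $\pi=\pi_1\cdots\pi_n$ of distinct positive integers; its descent composition $\mathrm{Comp}(\pi)$ is the composition of $n$ listing the lengths of its maximal increasing consecutive runs (the empty permutation has composition $\varnothing$). A descent statistic is a permutation statistic $\mathrm{st}$ whose value depends only on the descent composition; write $\mathrm{st}(L)$ for the common value on permutations with descent composition $L$. Compositions $L,M$ of the same $n$ are $\mathrm{st}$-equivalent if $\mathrm{st}(L)=\mathrm{st}(M)$. For disjoint permutations, $S(\pi,\sigma)$ is the set of shuffles (permutations of length $|\pi|+|\sigma|$ containing both as subsequences); $\mathrm{st}$ is shuffle-compatible if for disjoint $\pi,\sigma$ the multiset $\{\mathrm{st}(\tau):\tau\in S(\pi,\sigma)\}$ depends only on $\mathrm{st}(\pi),\mathrm{st}(\sigma),|\pi|,|\sigma|$; its shuffle algebra $\mathcal{A}_{\mathrm{st}}$ has basis the classes of permutations with equal length and $\mathrm{st}$-value and product $[\pi][\sigma]=\sum_{\tau\in S(\pi,\sigma)}[\tau]$. In the algebra $\mathbb{Q}\langle\langle X_1,X_2,\dots\rangle\rangle$ of formal power series in noncommuting variables, let $\mathbf{h}_n=\sum_{i_1\le\cdots\le i_n}X_{i_1}\cdots X_{i_n}$ ($\mathbf{h}_0=1$), $\mathbf{h}_L=\mathbf{h}_{L_1}\cdots\mathbf{h}_{L_k}$ for a composition $L$, and $\mathbf{Sym}$ the span of all $\mathbf{h}_L$. $\mathbf{Sym}$ is a bialgebra with comultiplication $\Delta$ the algebra homomorphism determined by $\Delta\mathbf{h}_n=\sum_{i=0}^n\mathbf{h}_i\otimes\mathbf{h}_{n-i}$.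 For a composition $L=(L_1,\dots,L_k)$ of $n$, the ribbon $\mathbf{r}_L=\sum X_{i_1}\cdots X_{i_n}$ summed over words $i_1\cdots i_n$ of positive integers that are weakly increasing within each of the consecutive blocks of lengths $L_1,\dots,L_k$ and strictly decrease from the last letter of each block to the first letter of the next. For an $\mathrm{st}$-equivalence class $\alpha$, $\mathbf{r}^{\mathrm{st}}_\alpha=\sum_{L\in\alpha}\mathbf{r}_L$. *)

(* Defs.v *)
From HB Require Import structures.
From mathcomp Require Import all_boot all_order all_algebra.
From mathcomp Require Import boolp classical_sets functions cardinality fsbigop.
From mathcomp Require Import finmap monalg zify.

Set Implicit Arguments.
Unset Strict Implicit.
Unset Printing Implicit Defensive.

Import GRing.Theory.
Local Open Scope classical_set_scope.
Local Open Scope quotient_scope.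
Local Open Scope ring_scope.

Record composition : Type := Composition {
  parts :> seq nat;
  parts_gt0 : all (ltn 0) parts }.

HB.instance Definition _ := [isSub for parts].
HB.instance Definition _ := [Countable of composition by <:].

(* Words of distinct positive integers, not necessarily 1, ..., n. *)
Record permutation : Type := Permutation {
  word :> seq nat;
  wordP : uniq word && all (ltn 0) word }.

HB.instance Definition _ := [isSub for word].
HB.instance Definition _ := [Countable of permutation by <:].

(* [run_lengths k x s]: lengths of the maximal increasing runs of a word, when
   the current run has length [k] and last letter [x], and [s] is still unread. *)
Fixpoint run_lengths (k x : nat) (s : seq nat) : seq nat :=
  if s is y :: s' then
    if (x < y)%N then run_lengths k.+1 y s' else k :: run_lengths 1 y s'
  else [:: k].

Definition descent_seq (s : seq nat) : seq nat :=
  if s is x :: s' then run_lengths 1 x s' else [::].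

Lemma descent_seq_gt0 s : all (ltn 0) (descent_seq s).
Proof.
case: s => //= x s.
have: forall k, (0 < k)%N -> all (ltn 0) (run_lengths k x s); last by apply.
elim: s x => [|y s IH] x k k0 /=; first by rewrite k0.
by case: ifP => _ /=; rewrite ?k0 IH.
Qed.

Definition descent_comp (p : permutation) : composition :=
  Composition (descent_seq_gt0 p).

Definition disjoint_perm (p q : permutation) : bool := ~~ has [in word q] p.

(* For disjoint [p] and [q], a shuffle is necessarily a rearrangement of
   [p ++ q]; see [mem_shuffles]. *)
Definition shuffles (p q : permutation) : seq permutation :=
  pmap insub [seq t <- permutations (p ++ q) | subseq p t && subseq q t].

Lemma shuffles_uniq p q : uniq (shuffles p q).
Proof.
apply: (pmap_uniq (g := val)); last by rewrite filter_uniq ?permutations_uniq.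
by move=> x; exact: insubK.
Qed.

Lemma mem_shuffles p q t : disjoint_perm p q ->
  (t \in shuffles p q) =
  [&& size t == (size p + size q)%N, subseq p t & subseq q t].
Proof.
move=> dpq; rewrite mem_pmap_sub mem_filter mem_permutations.
have [spt|] := boolP (subseq p _); last by rewrite andbF.
have [sqt|] := boolP (subseq q _); last by rewrite !andbF.
rewrite /= andbT -size_cat.
apply/idP/idP => [/perm_size->//|/eqP st].
have upq : uniq (p ++ q).
  have /andP[up _] := wordP p; have /andP[uq _] := wordP q.
  by rewrite cat_uniq up uq andbT has_sym.
have sub : {subset (p ++ q) <= val t}.
  by move=> x; rewrite mem_cat => /orP[] /mem_subseq; apply.
have /andP[ut _] := wordP t.
rewrite uniq_perm //.
have [_ e] := uniq_min_size upq sub (eq_leq st).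
by move=> x; rewrite e.
Qed.

(* The permutation of 1, ..., n with descent composition [L] whose runs are
   intervals. *)
Fixpoint canon_word (L : seq nat) : seq nat :=
  if L is a :: L' then iota (sumn L').+1 a ++ canon_word L' else [::].

Lemma mem_canon_word L x : (x \in canon_word L) = (0 < x <= sumn L)%N.
Proof.
elim: L => [|a L IH] /=; first by case: x.
by rewrite mem_cat mem_iota IH; lia.
Qed.

Lemma canon_wordP L : uniq (canon_word L) && all (ltn 0) (canon_word L).
Proof.
apply/andP; split; last first.
  by apply/allP => x; rewrite mem_canon_word => /andP[].
elim: L => //= a L IH; rewrite cat_uniq iota_uniq IH andbT /=.
apply/hasPn => x; rewrite mem_canon_word mem_iota => /andP[_ h].
by rewrite negb_and -ltnNge ltnS h.
Qed.

Definition canon_perm (L : composition) : permutation :=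
  Permutation (canon_wordP L).

Lemma canon_permK : cancel canon_perm descent_comp.
Proof.
case=> L Lp; apply: val_inj; rewrite /= /descent_seq.
have run k x a (s : seq nat) : (head 0 s <= x + a)%N ->
    run_lengths k x (iota x.+1 a ++ s) =
    (if s is y :: s' then (k + a)%N :: run_lengths 1 y s' else [:: (k + a)%N]).
  elim: a k x => [|a IH] k x /=.
    by rewrite !addn0; case: s => //= y s hs; rewrite ltnNge hs.
  by rewrite ltnSn -addSnnS => hs; rewrite IH // addSnnS.
elim: L Lp => //= -[|a] L IH //= Lp; rewrite run ?add1n.
  by have := IH Lp; case: (canon_word L) => [<-|y s ->].
have: all (leq^~ (sumn L)) (canon_word L).
  by apply/allP => x; rewrite mem_canon_word => /andP[].
case: (canon_word L) => //= y s /andP[h _].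
by rewrite (leq_trans h) // addSn ltnW // ltnS leq_addr.
Qed.

Definition descent_statistic (T : eqType) (st : permutation -> T) : Prop :=
  forall p q, descent_comp p = descent_comp q -> st p = st q.

Definition st_comp (T : eqType) (st : permutation -> T) (L : composition) : T :=
  st (canon_perm L).

Lemma st_compE (T : eqType) (st : permutation -> T) : descent_statistic st ->
  forall p, st_comp st (descent_comp p) = st p.
Proof. by move=> hst p; apply: hst; rewrite canon_permK. Qed.

Definition shuffle_compatible (T : eqType) (st : permutation -> T) : Prop :=
  forall p q p' q' : permutation,
    disjoint_perm p q -> disjoint_perm p' q' ->
    size p = size p' -> size q = size q' -> st p = st p' -> st q = st q' ->
    perm_eq [seq st t | t <- shuffles p q] [seq st t | t <- shuffles p' q'].

Definition comp_eqv (T : eqType) (st : permutation -> T) : rel composition :=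
  fun L M => (sumn L == sumn M) && (st_comp st L == st_comp st M).

Lemma comp_eqv_class T st : equiv_class_of (@comp_eqv T st).
Proof.
split=> [L|L M|L M N]; rewrite /comp_eqv ?eqxx //.
  by rewrite eq_sym [st_comp _ _ == _]eq_sym.
by move=> /andP[/eqP-> /eqP->].
Qed.

Canonical comp_equiv T st := EquivRelPack (@comp_eqv_class T st).

Definition comp_class (T : eqType) (st : permutation -> T) : Type :=
  {eq_quot comp_equiv st}.

HB.instance Definition _ T st := EqQuotient.on (@comp_class T st).
HB.instance Definition _ T st := Choice.on (@comp_class T st).

Definition perm_eqv (T : eqType) (st : permutation -> T) : rel permutation :=
  fun p q => (size p == size q) && (st p == st q).

Lemma perm_eqv_class T st : equiv_class_of (@perm_eqv T st).
Proof.
split=> [L|L M|L M N]; rewrite /perm_eqv ?eqxx //.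
  by rewrite eq_sym [st _ == _]eq_sym.
by move=> /andP[/eqP-> /eqP->].
Qed.

Canonical perm_equiv T st := EquivRelPack (@perm_eqv_class T st).

Definition perm_class (T : eqType) (st : permutation -> T) : Type :=
  {eq_quot perm_equiv st}.

HB.instance Definition _ T st := EqQuotient.on (@perm_class T st).
HB.instance Definition _ T st := Choice.on (@perm_class T st).

(* The free vector space on the classes of permutations with equal length and
   equal [st]-value. *)
Definition shuffle_alg (T : eqType) (st : permutation -> T) : Type :=
  {malg rat[perm_class st]}.

HB.instance Definition _ T st := GRing.Lmodule.copy (@shuffle_alg T st)
  {malg rat[perm_class st]}.

Definition perm_vec (T : eqType) (st : permutation -> T) (p : permutation) :
  shuffle_alg st := << \pi_(perm_class st) p >>.

Lemma shift_wordP k (q : permutation) :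
  uniq (map (addn k) q) && all (ltn 0) (map (addn k) q).
Proof.
have /andP[uq q0] := wordP q.
rewrite map_inj_uniq ?uq; last exact: addnI.
rewrite all_map; apply: sub_all q0 => x /= x0; exact: ltn_addl.
Qed.

Definition shift_perm (k : nat) (q : permutation) : permutation :=
  Permutation (shift_wordP k q).

Lemma descent_comp_shift k q : descent_comp (shift_perm k q) = descent_comp q.
Proof.
apply: val_inj; case: q => -[|x s] //= _.
elim: s x 1%N => //= y s IH x l.
by rewrite ltn_add2l !IH.
Qed.

Lemma disjoint_shift (p q : permutation) :
  disjoint_perm p (shift_perm (sumn p) q).
Proof.
apply/hasPn => x xp; apply/negP => /mapP[y yq ex].
have /andP[_ /allP/(_ _ yq)/= y0] := wordP q.
have : (x <= sumn p)%N.
  elim: (word p) xp => //= z s IH; rewrite inE => /orP[/eqP->|/IH]; lia.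
by rewrite ex; lia.
Qed.

(* The product is computed on representatives made disjoint by a shift; see
   [shuffle_mulE] for its independence of that choice. *)
Definition class_mul (T : eqType) (st : permutation -> T)
    (k l : perm_class st) : shuffle_alg st :=
  let p := repr k in let q := repr l in
  \sum_(t <- shuffles p (shift_perm (sumn p) q)) perm_vec st t.

Definition shuffle_mul (T : eqType) (st : permutation -> T)
    (x y : shuffle_alg st) : shuffle_alg st :=
  \sum_(k <- msupp x) \sum_(l <- msupp y) (x@_k * y@_l) *: class_mul k l.

Lemma shuffle_mulE (T : eqType) (st : permutation -> T) p q :
  descent_statistic st -> shuffle_compatible st -> disjoint_perm p q ->
  shuffle_mul (perm_vec st p) (perm_vec st q) =
  \sum_(t <- shuffles p q) perm_vec st t.
Proof.
move=> hst sc dpq.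
rewrite /shuffle_mul /perm_vec !msuppU oner_eq0 !big_seq_fset1 !mcoeffUU mulr1.
rewrite scale1r /class_mul.
set p' := repr _; set q' := shift_perm _ _.
have reprP r : size (repr (\pi_(perm_class st) r)) = size r /\
               st (repr (\pi_(perm_class st) r)) = st r.
  by have /eqquotP/andP[/eqP-> /eqP->] := reprK (\pi_(perm_class st) r).
have [sp tp] := reprP p; have [sq tq] := reprP q.
have dpq' : disjoint_perm p' q' by exact: disjoint_shift.
have szq : size q' = size q by rewrite size_map sq.
have stq : st q' = st q.
  by rewrite -tq; apply: hst; exact: descent_comp_shift.
have szpq : (size p' = size p)%N by [].
have pe := sc p' q' p q dpq' dpq sp szq tp stq.
apply/malgP => k; rewrite !(raddf_sum (mcoeff k)) /=.
have coefE (s : seq permutation) n : all (fun t : permutation => size t == n) s ->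
    \sum_(t <- s) (perm_vec st t)@_k =
    ((n == size (repr k)) * count (pred1 (st (repr k))) (map st s))%:R :> rat.
  elim: s => [|t s IH] /=; first by rewrite big_nil muln0.
  case/andP=> /eqP tn /IH {}IH; rewrite big_cons IH /perm_vec mcoeffU.
  have -> : (\pi_(perm_class st) t == k) =
            (n == size (repr k)) && (st t == st (repr k)).
    by rewrite -{1}[k]reprK eqquotE -tn.
  by case: eqP => //= _; rewrite !mul1n -natrD.
have sz a b : disjoint_perm a b ->
    all (fun t : permutation => size t == (size a + size b)%N) (shuffles a b).
  by move=> dab; apply/allP => t; rewrite mem_shuffles // => /and3P[].
rewrite (coefE _ _ (sz _ _ dpq')) (coefE _ _ (sz _ _ dpq)) szq sp.
by move/permP: pe => ->.
Qed.

(* The class of the permutations with descent composition in [a]; see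
   [perm_class_ofE]. *)
Definition perm_class_of (T : eqType) (st : permutation -> T)
    (a : comp_class st) : perm_class st :=
  \pi_(perm_class st) (canon_perm (repr a)).

Lemma sumn_descent_comp p : sumn (descent_comp p) = size p.
Proof.
case: p => -[|x s] //= _.
have run k : sumn (run_lengths k x s) = (k + size s)%N; last by rewrite run.
elim: s x k => [|y s IH] x k //=.
by case: ifP => _ /=; rewrite IH; lia.
Qed.

Lemma perm_class_ofE (T : eqType) (st : permutation -> T) p (a : comp_class st) :
  descent_statistic st ->
  (\pi_(perm_class st) p == perm_class_of a) =
  (\pi_(comp_class st) (descent_comp p) == a).
Proof.
move=> hst; rewrite -[in RHS](reprK a).
rewrite /perm_class_of !eqquotE /=.
rewrite /perm_eqv /comp_eqv.
have -> : size (canon_perm (repr a)) = sumn (repr a).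
  by rewrite -[LHS](sumn_descent_comp (canon_perm _)) canon_permK.
by rewrite sumn_descent_comp st_compE.
Qed.

Definition class_vec (T : eqType) (st : permutation -> T) (a : comp_class st) :
  shuffle_alg st := << perm_class_of a >>.

(* A series in noncommuting variables is the function giving the coefficient of
   each word; the letter [i] stands for the variable X_{i+1}. *)
Definition ncseries : Type := seq nat -> rat.

HB.instance Definition _ := GRing.Lmodule.copy ncseries (seq nat -> rat^o).

Definition nc1 : ncseries := fun w => (w == [::])%:R.

Definition ncmul (f g : ncseries) : ncseries := fun w =>
  \sum_(i < (size w).+1) f (take i w) * g (drop i w).

(* The tensor product of two spaces of series is identified with its image under
   the injection sending [f] (x) [g] to (u, v) |-> f u * g v. *)
Definition ncseries2 : Type := seq nat -> seq nat -> rat.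

HB.instance Definition _ :=
  GRing.Lmodule.copy ncseries2 (seq nat -> seq nat -> rat^o).

Definition tens (f g : ncseries) : ncseries2 := fun u v => f u * g v.

Definition ncmul2 (F G : ncseries2) : ncseries2 := fun u v =>
  \sum_(i < (size u).+1) \sum_(j < (size v).+1)
    F (take i u) (take j v) * G (drop i u) (drop j v).

Lemma ncmul2_tens f f' g g' :
  ncmul2 (tens f f') (tens g g') = tens (ncmul f g) (ncmul f' g').
Proof.
apply/funext => u; apply/funext => v; rewrite /tens /ncmul big_distrlr /=.
by apply: eq_bigr => i _; apply: eq_bigr => j _; rewrite mulrACA.
Qed.

Definition lin_span (V : lmodType rat) (S : set V) : set V :=
  [set x | exists s : seq (rat * V),
     (forall cv, cv \in s -> S cv.2) /\ x = \sum_(cv <- s) cv.1 *: cv.2].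

Definition tensor_space (A B : set ncseries) : set ncseries2 :=
  lin_span [set F : ncseries2 |
    exists f g, [/\ A f, B g & F = tens f g]].

Definition nch (n : nat) : ncseries := fun w =>
  ((size w == n) && sorted leq w)%:R.

Definition nchL (L : composition) : ncseries :=
  foldr ncmul nc1 [seq nch n | n <- L].

Definition NSym : set ncseries := lin_span (range nchL).

(* The blocks are those of [reshape L w]; they are nonempty, so the default
   values of [last] and [head] are irrelevant. *)
Definition ribbon (L : composition) : ncseries := fun w =>
  [&& size w == sumn L, all (sorted leq) (reshape L w) &
      sorted (fun b c => head 0 c < last 0 b)%N (reshape L w)]%:R.

Record is_comult (D : ncseries -> ncseries2) : Prop := IsComult {
  comult_tensor : forall f, NSym f -> tensor_space NSym NSym (D f);
  comult_linear : forall a f g, NSym f -> NSym g ->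
    D (a *: f + g) = a *: D f + D g;
  comult_one : D nc1 = tens nc1 nc1;
  comult_mul : forall f g, NSym f -> NSym g ->
    D (ncmul f g) = ncmul2 (D f) (D g);
  comult_nch : forall n,
    D (nch n) = \sum_(i < n.+1) tens (nch i) (nch (n - i)) }.

(* Existence of the comultiplication. The value of [f] at a word over two
   consecutive copies of the alphabet is obtained by shifting the letters of the
   second copy, and the two copies are made to commute. *)
Module ComultExists.

Lemma fct_sumE (I : Type) (r : seq I) (F : I -> ncseries) w :
  (\sum_(i <- r) F i) w = \sum_(i <- r) F i w.
Proof. by elim/big_rec2: _ => // i y1 y2 _ <-. Qed.

Lemma fct_sum2E (I : Type) (r : seq I) (F : I -> ncseries2) u v :
  (\sum_(i <- r) F i) u v = \sum_(i <- r) F i u v.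
Proof. by elim/big_rec2: _ => // i y1 y2 _ <-. Qed.

Fixpoint shuf (u : seq nat) : seq nat -> seq (seq nat) :=
  if u is x :: u' then
    fix shufx v := if v is y :: v' then
      map (cons x) (shuf u' v) ++ map (cons y) (shufx v')
    else [:: u]
  else fun v => [:: v].

Lemma shuf0 u : shuf u [::] = [:: u]. Proof. by case: u. Qed.

Lemma shufS x u y v : shuf (x :: u) (y :: v) =
  map (cons x) (shuf u (y :: v)) ++ map (cons y) (shuf (x :: u) v).
Proof. by []. Qed.

Lemma shuf_map phi u v : shuf (map phi u) (map phi v) = map (map phi) (shuf u v).
Proof.
elim: u v => // x u IHu; elim=> // y v IHv.
rewrite [map phi (_ :: u)]/= [map phi (_ :: v)]/= !shufS map_cat -!map_comp.
by rewrite -(map_cons phi y) IHu -(map_cons phi x) IHv -!map_comp.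
Qed.

Lemma shuf_perm u v w : w \in shuf u v -> perm_eq w (u ++ v).
Proof.
elim: u v w => [|x u IHu]; first by move=> v w; rewrite inE => /eqP->.
elim=> [|y v IHv] w; first by rewrite inE cats0 => /eqP->.
rewrite shufS mem_cat => /orP[] /mapP[w' w'in ->].
  by rewrite perm_cons IHu.
have := IHv _ w'in; rewrite -(perm_cons y) => /perm_trans; apply.
exact: permEl (perm_catCA [:: y] (x :: u) v).
Qed.

Fixpoint splits (w : seq nat) : seq (seq nat * seq nat) :=
  ([::], w) ::
  if w is x :: w' then [seq (x :: p.1, p.2) | p <- splits w'] else [::].

Lemma splitsE w : splits w = [seq (take i w, drop i w) | i <- iota 0 (size w).+1].
Proof.
elim: w => // x w IH; rewrite [LHS]/= IH -[size (x :: w)]/(size w).+1.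
have -> : iota 0 (size w).+2 = 0%N :: map (addn 1) (iota 0 (size w).+1).
  by rewrite -iotaDl.
by rewrite map_cons take0 -!map_comp.
Qed.

Lemma big_splits (F : seq nat -> seq nat -> rat) w :
  \sum_(p <- splits w) F p.1 p.2 =
  \sum_(i < (size w).+1) F (take i w) (drop i w).
Proof.
rewrite splitsE big_map -[iota _ _]/(index_iota 0 (size w).+1).
by rewrite big_mkord.
Qed.

Lemma big_splits_cons (G : seq nat * seq nat -> rat) x w :
  \sum_(p <- splits (x :: w)) G p =
  G ([::], x :: w) + \sum_(p <- splits w) G (x :: p.1, p.2).
Proof. by rewrite big_cons big_map. Qed.

Lemma ncmulE f g w : ncmul f g w = \sum_(p <- splits w) f p.1 * g p.2.
Proof. by rewrite (big_splits (fun a b => f a * g b)). Qed.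

Lemma ncmul2E F G u v :
  ncmul2 F G u v =
  \sum_(p <- splits u) \sum_(q <- splits v) F p.1 q.1 * G p.2 q.2.
Proof.
rewrite (big_splits (fun a b => \sum_(q <- splits v) F a q.1 * G b q.2)).
apply: eq_bigr => i _.
by rewrite (big_splits (fun a b => F (take i u) a * G (drop i u) b)).
Qed.

Lemma shuf0l v : shuf [::] v = [:: v]. Proof. by []. Qed.

Lemma splits0 : splits [::] = [:: ([::], [::])]. Proof. by []. Qed.

Arguments shuf : simpl never.
Arguments splits : simpl never.

Lemma shuf_splits (F : seq nat -> seq nat -> rat) u v :
  \sum_(w <- shuf u v) \sum_(p <- splits w) F p.1 p.2 =
  \sum_(p <- splits u) \sum_(q <- splits v)
    \sum_(a <- shuf p.1 q.1) \sum_(b <- shuf p.2 q.2) F a b.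
Proof.
elim: u v F => [|x u IHu].
  move=> v F; rewrite shuf0l splits0 !big_seq1 /=.
  by apply: eq_bigr => q _; rewrite !shuf0l !big_seq1.
elim=> [|y v IHv] F.
  rewrite shuf0 splits0 !big_seq1; apply: eq_bigr => p _.
  by rewrite !big_seq1 /= !shuf0 !big_seq1.
rewrite shufS big_cat !big_map /=.
under eq_bigr do rewrite big_splits_cons /=.
rewrite big_split /= (IHu _ (fun a => F (x :: a))).
under [X in _ + X = _]eq_bigr do rewrite big_splits_cons /=.
rewrite [X in _ + X = _]big_split /= (IHv (fun a => F (y :: a))).
rewrite [in RHS]big_splits_cons /= [in X in _ = X + _]big_splits_cons /=.
rewrite !shuf0l !big_seq1 shufS big_cat !big_map /=.
rewrite addrACA -[in RHS]addrA; congr (_ + _).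
rewrite [in X in _ + X = _]big_splits_cons /=.
rewrite addrCA; congr (_ + _).
  by apply: eq_bigr => q _; rewrite shuf0l !big_seq1.
rewrite -big_split /=; apply: eq_bigr => p _.
rewrite !big_splits_cons /= shuf0 !big_seq1 -addrA; congr (_ + _).
rewrite -big_split /=; apply: eq_bigr => q _.
by rewrite shufS big_cat !big_map.
Qed.

(* Coefficients of noncommutative symmetric functions are invariant under
   order-preserving relabelling. *)
Definition invariant (f : ncseries) := forall (phi : nat -> nat) w,
  {in w &, {mono phi : x y / (x <= y)%N}} -> f (map phi w) = f w.

Lemma invariant_nch n : invariant (nch n).
Proof. by move=> phi w phiP; rewrite /nch size_map (mono_sorted_in phiP (allss w)). Qed.

Lemma invariant_nc1 : invariant nc1.
Proof. by move=> phi [|x w]. Qed.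

Lemma invariant_mul f g : invariant f -> invariant g -> invariant (ncmul f g).
Proof.
move=> hf hg phi w phiP; rewrite /ncmul size_map; apply: eq_bigr => i _.
rewrite -map_take -map_drop hf ?hg // => x y xi yi; apply: phiP.
all: by rewrite ?(mem_take xi) ?(mem_take yi) ?(mem_drop xi) ?(mem_drop yi).
Qed.

Lemma invariant_nchL L : invariant (nchL L).
Proof.
rewrite /nchL; elim: (val L) => [|n s IH]; first exact: invariant_nc1.
by apply: invariant_mul => //; exact: invariant_nch.
Qed.

Lemma invariant_NSym f : NSym f -> invariant f.
Proof.
move=> [s [sP ->]] phi w phiP; rewrite !fct_sumE !big_seq.
apply: eq_bigr => cv /sP[L _ <-].
by rewrite -[LHS]/(cv.1 * _) invariant_nchL.
Qed.

Definition comultN N (f : ncseries) : ncseries2 := fun u v =>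
  \sum_(w <- shuf u (map (addn N) v)) f w.

Definition D (f : ncseries) : ncseries2 := fun u v => comultN (sumn u).+1 f u v.

Lemma comultNE N M f u v : invariant f -> (N <= M)%N -> all (ltn^~ N) u ->
  comultN M f u v = comultN N f u v.
Proof.
move=> hf NM /allP uN.
pose phi x := if (x < N)%N then x else (x - N + M)%N.
rewrite /comultN.
have -> : u = map phi u.
  by rewrite -[LHS]map_id; apply/eq_in_map => x /uN /= xN; rewrite /phi xN.
have -> : map (addn M) v = map phi (map (addn N) v).
  rewrite -map_comp; apply: eq_map => x /=; rewrite /phi ltnNge leq_addr /=; lia.
have {2}-> : map phi u = u.
  by rewrite -[RHS]map_id; apply/eq_in_map => x /uN /= xN; rewrite /phi xN.
rewrite shuf_map big_map; apply: eq_bigr => w _; apply: hf => x y _ _.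
by rewrite /phi; do 2!case: ltnP => ?; lia.
Qed.

Lemma all_lt_sumn u : all (ltn^~ (sumn u).+1) u.
Proof.
elim: u => //= x u IH; rewrite ltnS leq_addr /=.
by apply: sub_all IH => y /=; lia.
Qed.

Lemma D_mul f g : invariant f -> invariant g ->
  D (ncmul f g) = ncmul2 (D f) (D g).
Proof.
move=> hf hg; apply/funext => u; apply/funext => v.
rewrite /D; set N := (sumn u).+1.
transitivity (ncmul2 (comultN N f) (comultN N g) u v); last first.
  have cut i : (sumn (take i u) <= sumn u)%N /\ (sumn (drop i u) <= sumn u)%N.
    by rewrite -{2 4}(cat_take_drop i u) sumn_cat leq_addr leq_addl.
  apply: eq_bigr => i _; apply: eq_bigr => j _; have [c1 c2] := cut i.
  by congr (_ * _); apply: comultNE; rewrite ?all_lt_sumn.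
rewrite ncmul2E /comultN.
under eq_bigr do rewrite ncmulE.
rewrite (shuf_splits (fun a b => f a * g b)).
have sm : splits (map (addn N) v) =
    [seq (map (addn N) p.1, map (addn N) p.2) | p <- splits v].
  rewrite !splitsE size_map -map_comp; apply: eq_map => i /=.
  by rewrite -map_take -map_drop.
rewrite sm; apply: eq_bigr => p _; rewrite big_map; apply: eq_bigr => q _.
by rewrite big_distrlr.
Qed.

Lemma sorted_shuf u v : {in u & v, forall x y, (x < y)%N} ->
  \sum_(w <- shuf u v) (sorted leq w)%:R =
  (sorted leq u && sorted leq v)%:R :> rat.
Proof.
elim: u => [|x u IH] uv; first by rewrite shuf0l big_seq1.
case: v uv IH => [|y v] uv IH; first by rewrite shuf0 big_seq1 andbT.
rewrite shufS big_cat !big_map /= [X in _ + X]big1_seq ?addr0; last first.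
  move=> w /= /shuf_perm/perm_mem wE; rewrite path_sortedE; last exact: leq_trans.
  case: allP => //= /(_ x); rewrite wE mem_head => /(_ isT).
  by rewrite leqNgt uv ?mem_head.
have {}IH := IH (fun a b au => uv a b (mem_behead (s := x :: u) au)).
rewrite (path_sortedE leq_trans x u) -andbA -mulnb natrM -IH big_distrr /=.
rewrite big_seq [RHS]big_seq; apply: eq_bigr => w /shuf_perm wE.
rewrite path_sortedE; last exact: leq_trans.
rewrite (perm_all _ wE) all_cat -natrM mulnb.
have -> : all (leq x) (y :: v) = true; last by rewrite andbT.
by apply/allP => z zv; rewrite ltnW ?uv ?mem_head.
Qed.

Lemma D_nch n : D (nch n) = \sum_(i < n.+1) tens (nch i) (nch (n - i)).
Proof.
apply/funext => u; apply/funext => v; rewrite fct_sum2E /D /comultN.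
set N := (sumn u).+1.
have cnt u' v' : {in u' & v', forall x y, (x < y)%N} ->
    \sum_(w <- shuf u' v') nch n w =
    ((size u' + size v')%N == n)%:R * (sorted leq u' && sorted leq v')%:R.
  move=> uv; rewrite -(sorted_shuf uv) big_distrr /=.
  rewrite big_seq [RHS]big_seq; apply: eq_bigr => w /shuf_perm/perm_size.
  by rewrite /nch size_cat -natrM mulnb => ->.
rewrite cnt; last first.
  move=> x y xu /mapP[z _ ->]; have /allP/(_ _ xu)/= := all_lt_sumn u.
  by rewrite -/N => xN; exact: ltn_addr.
have -> : sorted leq (map (addn N) v) = sorted leq v.
  by apply: mono_sorted => x y /=; rewrite leq_add2l.
rewrite size_map /tens /nch -natrM mulnb.
have [sz|sz] := boolP ((size u + size v)%N == n); last first.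
  rewrite big1 // => i _; case: (_ =P _ :> nat) => [ui|]; last by rewrite mul0r.
  case: (_ =P _ :> nat) => [vi|]; last by rewrite mulr0.
  by move: sz; rewrite ui vi subnKC ?eqxx // -ltnS.
have un : (size u < n.+1)%N by rewrite ltnS -(eqP sz) leq_addr.
rewrite (bigD1 (Ordinal un)) //= big1 ?addr0; last first.
  move=> i /eqP neq; case: (_ =P _ :> nat) => [ui|]; last by rewrite mul0r.
  by case: neq; apply: val_inj.
have vn : size v == (n - size u)%N by rewrite -(eqP sz) addKn.
by rewrite eqxx vn /= -natrM mulnb.
Qed.

Lemma lin_span_mem (V : lmodType rat) (S : set V) x : S x -> lin_span S x.
Proof.
move=> Sx; exists [:: (1, x)]; rewrite big_seq1 scale1r; split=> // cv.
by rewrite inE => /eqP->.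
Qed.

Lemma lin_span_lin (V : lmodType rat) (S : set V) a x y :
  lin_span S x -> lin_span S y -> lin_span S (a *: x + y).
Proof.
move=> [s [sP ->]] [t [tP ->]].
exists ([seq (a * cv.1, cv.2) | cv <- s] ++ t); split=> [cv|].
  by rewrite mem_cat => /orP[/mapP[cv' /sP ? ->]|/tP].
rewrite big_cat big_map /= scaler_sumr; congr (_ + _).
by apply: eq_bigr => cv _; rewrite scalerA.
Qed.

Lemma lin_span_sum (V : lmodType rat) (S : set V) (I : eqType) (r : seq I)
    (a : I -> rat) (F : I -> V) :
  (forall i, i \in r -> lin_span S (F i)) ->
  lin_span S (\sum_(i <- r) a i *: F i).
Proof.
elim: r => [|i r IH] h.
  by rewrite big_nil; exists [::]; rewrite big_nil.
rewrite big_cons; apply: lin_span_lin; first by apply: h; rewrite mem_head.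
by apply: IH => j jr; apply: h; rewrite in_cons jr orbT.
Qed.

Lemma ncmul_suml (I : Type) (r : seq I) (a : I -> rat) (F : I -> ncseries) g :
  ncmul (\sum_(i <- r) a i *: F i) g = \sum_(i <- r) a i *: ncmul (F i) g.
Proof.
apply/funext => w; rewrite fct_sumE /ncmul.
under eq_bigr do rewrite fct_sumE big_distrl /=.
rewrite exchange_big /=; apply: eq_bigr => i _.
rewrite -[RHS]/(a i * _) big_distrr /=; apply: eq_bigr => j _.
by rewrite -[X in X * _]/(a i * _) mulrA.
Qed.

Lemma ncmul_sumr (I : Type) (r : seq I) (a : I -> rat) (F : I -> ncseries) g :
  ncmul g (\sum_(i <- r) a i *: F i) = \sum_(i <- r) a i *: ncmul g (F i).
Proof.
apply/funext => w; rewrite fct_sumE /ncmul.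
under eq_bigr do rewrite fct_sumE big_distrr /=.
rewrite exchange_big /=; apply: eq_bigr => i _.
rewrite -[RHS]/(a i * _) big_distrr /=; apply: eq_bigr => j _.
by rewrite -[X in _ * X]/(a i * _) mulrCA.
Qed.

Lemma ncmul2_sumr (I : Type) (r : seq I) (a : I -> rat) (F : I -> ncseries2) G :
  ncmul2 G (\sum_(i <- r) a i *: F i) = \sum_(i <- r) a i *: ncmul2 G (F i).
Proof.
apply/funext => u; apply/funext => v; rewrite fct_sum2E /ncmul2.
under eq_bigr do under eq_bigr do rewrite fct_sum2E big_distrr /=.
under eq_bigr do rewrite exchange_big /=.
rewrite exchange_big /=; apply: eq_bigr => i _.
rewrite -[RHS]/(a i * _) big_distrr /=; apply: eq_bigr => j _.
rewrite big_distrr /=; apply: eq_bigr => k _.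
by rewrite -[X in _ * X]/(a i * _) mulrCA.
Qed.

Lemma ncmul2_suml (I : Type) (r : seq I) (F : I -> ncseries2) G :
  ncmul2 (\sum_(i <- r) F i) G = \sum_(i <- r) ncmul2 (F i) G.
Proof.
apply/funext => u; apply/funext => v; rewrite fct_sum2E /ncmul2.
under eq_bigr do under eq_bigr do rewrite fct_sum2E big_distrl /=.
under eq_bigr do rewrite exchange_big /=.
by rewrite exchange_big.
Qed.

Lemma nch0 : nch 0 = nc1.
Proof. by apply/funext => -[|x w]. Qed.

Lemma ncmul1l f : ncmul nc1 f = f.
Proof.
apply/funext => w; rewrite /ncmul big_ord_recl take0 drop0 mul1r.
rewrite big1 ?addr0 // => i _.
by case: w i => [[]|x w i] //=; rewrite mul0r.
Qed.

Lemma NSym_nch_mul i f : NSym f -> NSym (ncmul (nch i) f).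
Proof.
move=> [s [sP ->]]; case: i => [|i].
  by rewrite nch0 ncmul1l; exists s.
rewrite ncmul_sumr; apply: lin_span_sum => cv /sP[L _ <-].
apply: lin_span_mem.
have Lp : all (ltn 0) (i.+1 :: L) by exact: parts_gt0.
by exists (Composition Lp).
Qed.

Lemma NSym1 : NSym nc1.
Proof. by apply: lin_span_mem; exists (@Composition [::] isT). Qed.

Lemma D_lin a f g : D (a *: f + g) = a *: D f + D g.
Proof.
apply/funext => u; apply/funext => v; rewrite /D /comultN.
by rewrite -[RHS]/(a * _ + _) big_distrr -big_split.
Qed.

Lemma D_sum (I : Type) (r : seq I) (a : I -> rat) (F : I -> ncseries) :
  D (\sum_(i <- r) a i *: F i) = \sum_(i <- r) a i *: D (F i).
Proof.
elim: r => [|i r IH]; last by rewrite !big_cons D_lin IH.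
rewrite !big_nil; apply/funext => u; apply/funext => v.
by rewrite /D /comultN big1.
Qed.

Lemma D_one : D nc1 = tens nc1 nc1.
Proof. by rewrite -nch0 D_nch big_ord1. Qed.

Lemma D_nchL L : tensor_space NSym NSym (D (nchL L)).
Proof.
rewrite /nchL; elim: (val L) => [|n s IH] /=.
  rewrite D_one; apply: lin_span_mem.
  by exists nc1, nc1; split=> //; exact: NSym1.
have inv : invariant (foldr ncmul nc1 [seq nch n | n <- s]).
  elim: {IH} s => [|m s IH]; first exact: invariant_nc1.
  by apply: invariant_mul => //; exact: invariant_nch.
rewrite D_mul //; last exact: invariant_nch.
move: IH => [t [tP ->]]; rewrite ncmul2_sumr; apply: lin_span_sum => cv /tP.
move=> [f [g [Sf Sg ->]]]; rewrite D_nch ncmul2_suml.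
under eq_bigr do rewrite ncmul2_tens -[tens _ _]scale1r.
apply: lin_span_sum => i _; apply: lin_span_mem.
by do 2!eexists; split; last by []; exact: NSym_nch_mul.
Qed.

Lemma comult_exists : exists D, is_comult D.
Proof.
exists D; split.
- move=> f [s [sP ->]]; rewrite D_sum; apply: lin_span_sum => cv /sP[L _ <-].
  exact: D_nchL.
- by move=> a f g _ _; exact: D_lin.
- exact: D_one.
- by move=> f g Sf Sg; apply: D_mul; exact: invariant_NSym.
- exact: D_nch.
Qed.

End ComultExists.

(* Only the values on [NSym], which [is_comult] determines, are meaningful. *)
Definition comult : ncseries -> ncseries2 :=
  projT1 (cid ComultExists.comult_exists).

Lemma comultP : is_comult comult.
Proof. exact: projT2 (cid ComultExists.comult_exists). Qed.

Definition subcoalgebra (C : set ncseries) : Prop :=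
  [/\ lin_span C = C, C `<=` NSym &
      forall f, C f -> tensor_space C C (comult f)].

Lemma finite_comp_class (T : eqType) (st : permutation -> T)
    (a : comp_class st) :
  finite_set [set L : composition | \pi_(comp_class st) L = a].
Proof.
pose n := sumn (repr a).
have fin : finite_set [set` (pmap insub (permutations (iota 1 n)) :
    seq permutation)] by exact: finite_seq.
apply: (sub_finite_set _ (finite_image descent_comp fin)) => L /= La.
exists (canon_perm L); last exact: canon_permK.
rewrite /= mem_pmap_sub mem_permutations uniq_perm ?iota_uniq //.
  by have /andP[] := canon_wordP L.
have /eqP : \pi_(comp_class st) L = \pi_(comp_class st) (repr a).
  by rewrite La reprK.
rewrite eqquotE => /andP[/eqP nL _] x.
by rewrite mem_canon_word mem_iota nL -/n; lia.
Qed.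

(* By [finite_comp_class], the [fsbigop] sum is an ordinary finite sum. *)
Definition ribbon_st (T : eqType) (st : permutation -> T)
    (a : comp_class st) : ncseries :=
  \sum_(L \in [set L : composition | \pi_(comp_class st) L = a]) ribbon L.

(* [c] has finite support, as the sum lies in the algebraic tensor product. *)
Definition comult_expansion (T : eqType) (st : permutation -> T)
    (a : comp_class st) (c : comp_class st -> comp_class st -> rat) : Prop :=
  finite_set [set bg | c bg.1 bg.2 != 0] /\
  comult (ribbon_st a) =
    \sum_(bg \in [set: comp_class st * comp_class st])
      c bg.1 bg.2 *: tens (ribbon_st bg.1) (ribbon_st bg.2).

(* Main.v *)
(* Multiplying a ribbon by [h_a] yields two ribbons, so [NSym] is the span of the
   ribbons, and the coefficient of an element of [NSym] at a word only depends on
   the lengths of the maximal weakly increasing runs of that word. Since shuffling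
   is compatible with deconcatenation, for words [u] and [v] without a common
   letter the coefficient of [comult f] at (u, v) is the sum of the coefficients
   of [f] over the shuffles of [u] and [v]. Hence the coefficient of the
   coproduct of the class sum of [a] at two disjoint permutations counts their
   shuffles in the class [a]. An expansion in class sums exists exactly when this
   count depends only on the classes of the two permutations, which is
   shuffle-compatibility, and its coefficients are these counts. *)

Require Import Defs.
From HB Require Import structures.
From mathcomp Require Import all_boot all_order all_algebra.
From mathcomp Require Import boolp classical_sets functions cardinality fsbigop.
From mathcomp Require Import finmap monalg zify.

Set Implicit Arguments.
Unset Strict Implicit.
Unset Printing Implicit Defensive.

Import GRing.Theory Num.Theory.
Local Open Scope classical_set_scope.
Local Open Scope quotient_scope.
Local Open Scope ring_scope.

Import ComultExists.

(** * Weakly increasing runs and the coefficients of ribbons *)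

Fixpoint weak_runs (k x : nat) (s : seq nat) : seq nat :=
  if s is y :: s' then
    if (x <= y)%N then weak_runs k.+1 y s' else k :: weak_runs 1 y s'
  else [:: k].

Definition weak_seq (s : seq nat) : seq nat :=
  if s is x :: s' then weak_runs 1 x s' else [::].

Lemma weak_seq_gt0 s : all (ltn 0) (weak_seq s).
Proof.
case: s => //= x s.
have: forall k, (0 < k)%N -> all (ltn 0) (weak_runs k x s); last by apply.
elim: s x => [|y s IH] x k k0 /=; first by rewrite k0.
by case: ifP => _ /=; rewrite ?k0 IH.
Qed.

Definition weak_comp (s : seq nat) : composition := Composition (weak_seq_gt0 s).

(** Links the weak runs seen by ribbons with the strict runs that define descent compositions. *)
Lemma weak_seq_uniq s : uniq s -> weak_seq s = descent_seq s.
Proof.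
case: s => //= x s; elim: s x 1%N => //= y s IH x k.
rewrite inE negb_or -andbA => /and4P[xy _ ys us].
by rewrite leq_eqVlt (negPf xy) /= !IH ?ys.
Qed.

Lemma weak_comp_perm (p : permutation) : weak_comp p = descent_comp p.
Proof. by apply: val_inj; apply: weak_seq_uniq; have /andP[] := wordP p. Qed.

Lemma weak_compK (L : composition) : weak_comp (canon_word L) = L.
Proof. by rewrite -[RHS]canon_permK -weak_comp_perm. Qed.

Lemma sumn_weak_seq s : sumn (weak_seq s) = size s.
Proof.
case: s => //= x s.
have run k : sumn (weak_runs k x s) = (k + size s)%N; last by rewrite run.
elim: s x k => [|y s IH] x k //=.
by case: ifP => _ /=; rewrite IH; lia.
Qed.

Lemma weak_seq_eq_nil s : (weak_seq s == [::]) = (s == [::]).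
Proof.
apply/eqP/eqP => [e|->//].
by apply: size0nil; rewrite -sumn_weak_seq e.
Qed.

(** A maximal run is a weakly increasing prefix followed by a descent or by the end of the word. The
    current length [k] is kept general so that induction on [a] can absorb one letter at a time. *)
Lemma weak_runs_eq_cons k x s a L :
  (weak_runs k x s == (k + a)%N :: L) =
  [&& (a <= size s)%N, path leq x (take a s),
      nilp (drop a s) || (head 0 (drop a s) < last x (take a s))%N &
      weak_seq (drop a s) == L].
Proof.
(* The current run can only grow, which rules out [a = 0] when the next letter continues it. *)
have head_runs k' x' s' : (k' <= head 0 (weak_runs k' x' s'))%N.
  elim: s' k' x' => //= y s' IH k' x'; case: ifP => // _.
  exact: leq_trans (IH _ _).
elim: a k x s => [|a IH] k x [|y s] /=; rewrite ?addn0 ?eqseq_cons.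
- by rewrite eqxx.
- case: (leqP x y) => xy /=; last by rewrite eqseq_cons eqxx.
  by apply/eqP => e; have := head_runs k.+1 y s; rewrite e /= ltnn.
- by rewrite (_ : (k == _) = false) //; lia.
case: (leqP x y) => xy /=; first by rewrite -addSnnS IH.
by rewrite eqseq_cons (_ : (k == _) = false) ?andbF //; lia.
Qed.

Lemma weak_seq_eq_cons w a L : (0 < a)%N ->
  (weak_seq w == a :: L) =
  [&& (a <= size w)%N, sorted leq (take a w),
      nilp (drop a w) || (head 0 (drop a w) < last 0 (take a w))%N &
      weak_seq (drop a w) == L].
Proof. by case: a w => [|a] [|x s] //= _; rewrite -(weak_runs_eq_cons 1 x). Qed.

(** Blocks that are weakly increasing and separated by descents are exactly the maximal weak runs.
    Ribbons are thus indicator functions of disjoint sets of words. *)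
Lemma ribbonE L w : ribbon L w = (weak_seq w == L)%:R.
Proof.
rewrite /ribbon; congr (nat_of_bool _)%:R; case: L => L /=.
elim: L w => [|a L IH] w /=.
  by rewrite weak_seq_eq_nil; case: w.
case/andP=> a0 L0; rewrite weak_seq_eq_cons // -(IH _ L0).
have [aw|wa] := leqP a (size w); last first.
  by rewrite (_ : (size w == _) = false) //; lia.
rewrite size_drop (_ : (_ == _) = (size w - a == sumn L)%N); last lia.
case: eqP => [sw|] /=; last by rewrite !andbF.
case: L L0 {IH} sw => [|b L] /= L0 sw.
  (* The word ends with its first block, so the descent condition is vacuous. *)
  by rewrite drop_oversize ?size_drop /= ?andbT //; lia.
have {L0} b0 : (0 < b)%N by case/andP: L0.
have -> : nilp (drop a w) = false by rewrite /nilp size_drop; lia.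
case: b b0 sw => // b _; case: (drop a w) => [|y v] _ /=; rewrite -?andbA.
all: by case: (_ < last _ _)%N; rewrite ?andbF.
Qed.

(** * Multiplication by [nch a], and ribbons as a spanning set of [NSym] *)

Lemma ncmul_nchE a f w :
  ncmul (nch a) f w =
  ((a <= size w)%N && sorted leq (take a w))%:R * f (drop a w).
Proof.
rewrite /ncmul /nch; have [aw|wa] := leqP a (size w); last first.
  rewrite mul0r big1 // => i _; rewrite size_take_min.
  by rewrite (_ : (_ == a) = false) ?mul0r //; have := ltn_ord i; lia.
rewrite (bigD1 (Ordinal (n := (size w).+1) aw)) //= big1 ?addr0 => [|i /eqP ia].
  by rewrite size_takel // eqxx.
rewrite size_takel; last by rewrite -ltnS.
by case: eqP => [ei|]; [case: ia; apply: val_inj | rewrite mul0r].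
Qed.

Lemma ribbon_nil (L0 : all (ltn 0) [::]) : ribbon (Composition L0) = nc1.
Proof. by apply/funext => w; rewrite ribbonE weak_seq_eq_nil. Qed.

Lemma ncmul_nch1 a (a0 : all (ltn 0) [:: a]) :
  ncmul (nch a) nc1 = ribbon (Composition a0).
Proof.
apply/funext => w; rewrite ncmul_nchE ribbonE weak_seq_eq_cons; last first.
  by case/andP: a0.
rewrite weak_seq_eq_nil /nc1.
by case: (drop a w) => [|y s] /=; rewrite ?andbF ?mulr0 // !andbT mulr1.
Qed.

(* Multiplying by [h_a] either keeps or merges the first two blocks, according
   to whether there is a descent after position [a]. *)
Lemma ncmul_nch_ribbon a b s (bs : all (ltn 0) (b :: s))
    (abs : all (ltn 0) [:: a, b & s]) (ab_s : all (ltn 0) ((a + b)%N :: s)) :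
  ncmul (nch a) (ribbon (Composition bs)) =
  ribbon (Composition abs) + ribbon (Composition ab_s).
Proof.
apply/funext => w; rewrite ncmul_nchE -[RHS]/(ribbon _ w + ribbon _ w) !ribbonE /=.
have [a0 b0] : (0 < a)%N /\ (0 < b)%N by case/and3P: abs.
rewrite !weak_seq_eq_cons ?addn_gt0 ?a0 //.
rewrite size_drop drop_drop (addnC b a) takeD.
have [aw|wa] := leqP a (size w); last first.
  by rewrite (_ : (a + b <= _)%N = false) ?mul0r ?addr0 //; lia.
rewrite leq_subRL //=; have [abw|_] := leqP (a + b) (size w); last first.
  by rewrite !andbF mulr0 addr0.
have ta : size (take a w) = a by rewrite size_takel.
have tb : size (take b (drop a w)) = b by rewrite size_takel // size_drop; lia.
have -> : nilp (drop a w) = false by rewrite /nilp size_drop; lia.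
case: (take a w) ta => [|x u] /=; first lia.
case: (drop a w) tb => [|y v] //=; first lia.
case: b {bs abs ab_s abw} b0 => // b _ /= _ _.
rewrite cat_path /= last_cat /=.
case: (path leq x u) => /=; last by rewrite mul0r addr0.
by rewrite mul1r; case: (leqP (last x u) y) => _ /=; rewrite ?add0r ?addr0.
Qed.

Lemma NSym_lin a f g : NSym f -> NSym g -> NSym (a *: f + g).
Proof. exact: lin_span_lin. Qed.

(** [ncmul_nch_ribbon] is solved for the ribbon with the most parts. Merging two parts does not give
    a tail of the list, hence the induction on a bound for the number of parts. *)
Lemma NSym_ribbon L : NSym (ribbon L).
Proof.
case: L => L; elim: {L}(size L) {-2}L (leqnn (size L)) => [|n IH].
all: case=> [|a [|b L]] // sL aL.
- by rewrite ribbon_nil; exact: NSym1.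
- by rewrite ribbon_nil; exact: NSym1.
- by rewrite -ncmul_nch1; apply: NSym_nch_mul; exact: NSym1.
have /and3P[a0 b0 L0] : [&& (0 < a)%N, (0 < b)%N & all (ltn 0) L] := aL.
have bL : all (ltn 0) (b :: L) by rewrite /= b0.
have abL : all (ltn 0) ((a + b)%N :: L) by rewrite /= addn_gt0 a0.
have -> : ribbon (Composition aL) =
    -1 *: ribbon (Composition abL) + ncmul (nch a) (ribbon (Composition bL)).
  by rewrite (ncmul_nch_ribbon _ aL abL) scaleN1r addrCA addNr addr0.
apply: NSym_lin; first by apply: IH.
by apply: NSym_nch_mul; apply: IH.
Qed.

(** The span of the ribbons contains the unit and, by [ncmul_nch_ribbon], is stable under left
    multiplication by each [nch n]. *)
Lemma NSym_sub_ribbons : NSym `<=` lin_span (range ribbon).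
Proof.
have mul n f : (0 < n)%N -> lin_span (range ribbon) f ->
    lin_span (range ribbon) (ncmul (nch n) f).
  move=> n0 [s [sP ->]]; rewrite ncmul_sumr; apply: lin_span_sum => cv /sP[].
  have n1 : all (ltn 0) [:: n] by rewrite /= n0.
  case=> [[|b L] bL] _ <-.
    by rewrite ribbon_nil (ncmul_nch1 n1); apply: lin_span_mem; eexists.
  have nbL : all (ltn 0) [:: n, b & L] by rewrite /= n0.
  have nb_L : all (ltn 0) ((n + b)%N :: L).
    by case/andP: bL => _ L0; rewrite /= addn_gt0 n0.
  rewrite (ncmul_nch_ribbon bL nbL nb_L) -[ribbon _]scale1r.
  by apply: lin_span_lin; apply: lin_span_mem; eexists.
move=> f [s [sP ->]]; apply: lin_span_sum => cv /sP[[L L0] _ <-].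
rewrite /nchL /=; elim: L L0 => [|n L IH] /=.
  by move=> nil0; rewrite -(ribbon_nil nil0); apply: lin_span_mem; eexists.
by case/andP=> n0 /IH; apply: mul.
Qed.

(** * Evaluation of series and of coproducts at words *)

Lemma lin_span_eval (S : set ncseries) u v :
  (forall f, S f -> f u = f v) -> forall f, lin_span S f -> f u = f v.
Proof.
move=> Suv f [s [sP ->]]; rewrite !fct_sumE.
by apply: eq_big_seq => cv /sP/Suv e; rewrite -[LHS]/(_ * _) e.
Qed.

Lemma tensor_space_eval (A B : set ncseries) u u' v v' :
  (forall f, A f -> f u = f u') -> (forall f, B f -> f v = f v') ->
  forall F, tensor_space A B F -> F u v = F u' v'.
Proof.
move=> Au Bv F [s [sP ->]]; rewrite !fct_sum2E.
apply: eq_big_seq => cv /sP[f [g [/Au fu /Bv gv e]]].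
by rewrite -[LHS]/(_ * _) e /tens fu gv.
Qed.

Lemma NSym_eval f u v : NSym f -> weak_seq u = weak_seq v -> f u = f v.
Proof.
move=> /NSym_sub_ribbons Sf uv; apply: lin_span_eval Sf => _ [L _ <-].
by rewrite !ribbonE uv.
Qed.

Lemma NSym_nch n : NSym (nch n).
Proof.
case: n => [|n]; first by rewrite nch0; exact: NSym1.
apply: lin_span_mem; exists (@Composition [:: n.+1] isT) => //.
apply/funext => w; rewrite /nchL /= ncmul_nchE /nc1 /nch -natrM mulnb.
rewrite -size_eq0 size_drop subn_eq0.
case: (ltngtP n.+1 (size w)) => nw; rewrite ?andbF //.
by rewrite nw take_size andbT.
Qed.

Lemma comult_eval f u u' v v' : NSym f ->
  weak_seq u = weak_seq u' -> weak_seq v = weak_seq v' ->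
  comult f u v = comult f u' v'.
Proof.
move=> /(comult_tensor comultP) Df uu' vv'.
by apply: tensor_space_eval Df => g Sg; apply: NSym_eval.
Qed.

(** * The coproduct as a sum over shuffles *)

Lemma comult_sum (I : eqType) (r : seq I) (a : I -> rat) (F : I -> ncseries) :
  (forall i, i \in r -> NSym (F i)) ->
  comult (\sum_(i <- r) a i *: F i) = \sum_(i <- r) a i *: comult (F i).
Proof.
elim: r => [_|i r IH h].
  (* The linearity axiom only concerns [a *: f + g]; writing 0 as [-1 *: nc1 + nc1] gives the value
     of [comult] at 0. *)
  have := comult_linear comultP (-1) NSym1 NSym1.
  by rewrite !scaleN1r !addNr !big_nil.
have hr j : j \in r -> NSym (F j) by move=> jr; apply: h; rewrite inE jr orbT.
rewrite !big_cons (comult_linear comultP) ?IH //; first exact/h/mem_head.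
exact: lin_span_sum.
Qed.

(** A sorted shuffle starts with the smaller of the two first letters, so only one branch of [shuf]
    contributes at each stage. Unlike in [sorted_shuf], the letters of [u] and [v] may
    interleave. *)
Lemma sorted_shuf_disjoint u v : ~~ has [in u] v ->
  \sum_(w <- shuf u v) (sorted leq w)%:R =
  (sorted leq u && sorted leq v)%:R :> rat.
Proof.
have lo x u' y v' s : (x < y)%N -> {in s, forall w, perm_eq w (u' ++ y :: v')} ->
    \sum_(w <- s) (sorted leq w)%:R =
      (sorted leq u' && sorted leq (y :: v'))%:R :> rat ->
    \sum_(w <- s) (sorted leq (x :: w))%:R =
    (sorted leq (x :: u') && sorted leq (y :: v'))%:R :> rat.
  move=> xy sP sE; rewrite [sorted _ (x :: u')]/=.
  rewrite (path_sortedE leq_trans x u') -andbA.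
  (* Sortedness bounds the letters of [y :: v'] below by [y], hence by [x]. Adding this condition
     bounds every letter of a shuffle by [x]. *)
  have -> : sorted leq (y :: v') = all (leq x) (y :: v') && sorted leq (y :: v').
    rewrite /= path_sortedE; last exact: leq_trans.
    case: allP => [yv|]; rewrite ?andbF //= (ltnW xy) /=.
    by have -> : all (leq x) v' by apply/allP => z /yv; apply/leq_trans/ltnW.
  rewrite [X in _ && X]andbCA andbA -all_cat -mulnb natrM -sE.
  rewrite big_distrr /= big_seq [RHS]big_seq.
  apply: eq_bigr => w /sP wE; rewrite path_sortedE; last exact: leq_trans.
  by rewrite (perm_all _ wE) -natrM mulnb.
(* If the larger letter comes first, the smaller one occurs after it. *)
have hi x y s : (x < y)%N -> {in s, forall w : seq nat, x \in w} ->
    \sum_(w <- s) (sorted leq (y :: w))%:R = 0 :> rat.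
  move=> xy sx; apply: big1_seq => w /= /sx xw.
  rewrite path_sortedE; last exact: leq_trans.
  by case: allP => // /(_ _ xw); rewrite leqNgt xy.
elim: u v => [|x u IHu]; first by move=> v _; rewrite shuf0l big_seq1.
elim=> [|y v IHv] uv; first by rewrite shuf0 big_seq1 andbT.
rewrite shufS big_cat !big_map /=.
have uv1 : ~~ has [in u] (y :: v).
  by apply: contra uv; apply: sub_has => z; rewrite !inE => ->; rewrite orbT.
have uv2 : ~~ has [in x :: u] v by apply: contra uv => /= ->; rewrite orbT.
have [xy|yx|exy] := ltngtP x y; last by rewrite exy /= mem_head in uv.
- rewrite (lo x u y v) //; last exact: IHu.
    rewrite (hi x y) ?addr0 // => w /shuf_perm/perm_mem->.
    by rewrite mem_head.
  by move=> w /shuf_perm.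
rewrite (hi y x) ?add0r // => [|w /shuf_perm/perm_mem->]; last first.
  by rewrite mem_cat mem_head orbT.
rewrite andbC; apply: lo => //; last by rewrite andbC; apply: IHv.
by move=> w /shuf_perm/perm_trans; apply; rewrite perm_catC.
Qed.

Lemma nch_shuf_disjoint n u v : ~~ has [in u] v ->
  \sum_(w <- shuf u v) nch n w =
  ((size u + size v)%N == n)%:R * (sorted leq u && sorted leq v)%:R.
Proof.
move=> uv; rewrite -(sorted_shuf_disjoint uv) big_distrr /=.
rewrite big_seq [RHS]big_seq; apply: eq_bigr => w /shuf_perm/perm_size.
by rewrite /nch size_cat -natrM mulnb => ->.
Qed.

(** On [nch n], [comult] agrees with the explicit [D], which shifts the letters of [v] above those
    of [u]. The shift is harmless, as both shuffle sums depend only on lengths and sortedness. *)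
Lemma comult_nch_disjoint n u v : ~~ has [in u] v ->
  comult (nch n) u v = \sum_(w <- shuf u v) nch n w.
Proof.
move=> uv; rewrite (comult_nch comultP) -D_nch /D /comultN !nch_shuf_disjoint //.
  rewrite size_map; congr (_ * (_ && _)%:R).
  by apply: mono_sorted => x y /=; rewrite leq_add2l.
apply/hasPn => _ /mapP[z _ ->]; apply/negP => /(allP (all_lt_sumn u)) /=; lia.
Qed.

Lemma mem_splits p w : p \in splits w -> p.1 ++ p.2 = w.
Proof. by rewrite splitsE => /mapP[i _ ->]; exact: cat_take_drop. Qed.

(* The letters of [u] and [v] may interleave arbitrarily: this is what makes the
   descent composition itself shuffle-compatible, as the left-hand side only
   depends on [weak_seq u] and [weak_seq v]. *)
Lemma comult_disjoint f u v : NSym f -> ~~ has [in u] v ->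
  comult f u v = \sum_(w <- shuf u v) f w.
Proof.
move=> [s [sP ->]] uv; rewrite comult_sum => [|cv /sP[L _ <-]]; last first.
  by apply: lin_span_mem; exists L.
rewrite fct_sum2E; under [RHS]eq_bigr do rewrite fct_sumE.
rewrite exchange_big /=; apply: eq_big_seq => cv /sP[[L L0] _ <-].
rewrite -[LHS]/(cv.1 * _) -[RHS]/(\sum_(w <- _) cv.1 * _) -big_distrr /=.
congr (_ * _); rewrite /nchL /= {s sP}.
elim: L L0 u v uv => [_|n L IH /= /andP[n0 L0]] u v uv /=.
  by rewrite -nch0 comult_nch_disjoint.
rewrite (comult_mul comultP); last 2 first.
- exact: NSym_nch.
- by apply: lin_span_mem; exists (Composition L0).
rewrite ncmul2E; under [RHS]eq_bigr do rewrite ncmulE.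
(* Cutting a shuffle in two amounts to cutting [u] and [v] and shuffling the prefixes and the
   suffixes separately, which is the shape of [ncmul2]. *)
rewrite (shuf_splits (fun a b => nch n a * _ b)).
apply: eq_big_seq => p /mem_splits pu; apply: eq_big_seq => q /mem_splits qv.
have [d1 d2] : ~~ has [in p.1] q.1 /\ ~~ has [in p.2] q.2.
  by split; apply: contra uv => /hasP[z zq zp]; apply/hasP; exists z;
    rewrite -?pu -?qv /= mem_cat ?zp ?zq ?orbT.
by rewrite comult_nch_disjoint // IH // big_distrlr.
Qed.

(** * Shuffles of words and shuffles of permutations *)

Lemma shuf_subseq u v w : w \in shuf u v -> subseq u w && subseq v w.
Proof.
elim: u v w => [|x u IHu] v w.
  by rewrite shuf0l inE => /eqP->; rewrite ?sub0seq subseq_refl.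
elim: v w => [|y v IHv] w.
  by rewrite shuf0 inE => /eqP->; rewrite ?sub0seq subseq_refl.
rewrite shufS mem_cat => /orP[] /mapP[w' w'in ->].
  have /andP[uw vw] := IHu _ _ w'in.
  by rewrite [subseq (x :: u) _]/= eqxx uw (subseq_trans vw) // subseq_cons.
have /andP[uw vw] := IHv _ w'in.
by rewrite andbC [subseq (y :: v) _]/= eqxx vw (subseq_trans uw) // subseq_cons.
Qed.

(** Without repeated letters, the first letter of [w] must be the head of exactly one of [u] and
    [v], and this determines the branch of [shuf]. *)
Lemma mem_shuf u v w : uniq (u ++ v) ->
  (w \in shuf u v) = [&& perm_eq w (u ++ v), subseq u w & subseq v w].
Proof.
move=> uv; apply/idP/idP => [wuv|]; first by rewrite shuf_perm ?shuf_subseq.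
elim: u v w uv => [|x u IHu] v w uv.
  case/and3P=> /perm_size sw _ vw; rewrite shuf0l inE eq_sym.
  by rewrite -(size_subseq_leqif vw) sw.
elim: v w uv => [|y v IHv] w uv.
  case/and3P=> /perm_size sw uw _; rewrite shuf0 inE eq_sym.
  by rewrite -(size_subseq_leqif uw) sw cats0.
case: w => [|z w] /and3P[pw uw vw]; first by [].
have /andP[zw _] : uniq (z :: w) by rewrite (perm_uniq pw).
have xy : x != y.
  by apply: contraL uv => /eqP->; rewrite cat_uniq /= mem_head !andbF.
rewrite shufS mem_cat; move: pw uw vw; rewrite /=.
have [<-{z zw}|xz] := eqVneq x z.
  rewrite eq_sym (negPf xy) => pw uw vw.
  rewrite (mem_map (can_inj (g := behead) _)) ?IHu //.
    by case/andP: uv.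
  by rewrite -(perm_cons x) pw uw.
have [<-{z zw xz}|yz] := eqVneq y z => pw uw vw.
  rewrite orbC (mem_map (can_inj (g := behead) _)) ?IHv //.
    move: uv; rewrite (perm_uniq (permEl (perm_catCA (x :: u) [:: y] v))).
    by case/andP.
  rewrite uw vw andbT -(perm_cons y) (perm_trans pw) //.
  exact: permEl (perm_catCA (x :: u) [:: y] v).
(* If [z] heads neither word, both embed in the tail of the shuffle, where [z] would occur a second
   time. *)
have : z \in (x :: u) ++ y :: v by rewrite -(perm_mem pw) mem_head.
by rewrite mem_cat => /orP[] /(mem_subseq _) zi; rewrite zi in zw.
Qed.

Lemma shuf_uniq u v : uniq (u ++ v) -> uniq (shuf u v).
Proof.
elim: u v => [|x u IHu] v //.
elim: v => [|y v IHv] uv; first by rewrite shuf0.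
have xy : x != y.
  by apply: contraL uv => /eqP->; rewrite cat_uniq /= mem_head !andbF.
rewrite shufS cat_uniq !map_inj_uniq; try by move=> ? ? [].
have uv' : uniq ((x :: u) ++ v).
  move: uv; rewrite (perm_uniq (permEl (perm_catCA (x :: u) [:: y] v))).
  by case/andP.
rewrite IHu ?IHv //; last by case/andP: uv.
rewrite andbT; apply/hasPn => _ /mapP[w _ ->]; apply/mapP => -[w' _ [yx _]].
by rewrite yx eqxx in xy.
Qed.

(** Turns the recursive sums over [shuf] into sums over the shuffles that define
    shuffle-compatibility. *)
Lemma perm_shuffles p q : disjoint_perm p q ->
  perm_eq [seq val t | t <- shuffles p q] (shuf p q).
Proof.
move=> dpq.
have upq : uniq (p ++ q).
  have /andP[up _] := wordP p; have /andP[uq _] := wordP q.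
  by rewrite cat_uniq up uq andbT has_sym.
apply: uniq_perm; first by rewrite map_inj_uniq ?shuffles_uniq //; exact: val_inj.
  exact: shuf_uniq.
move=> w; rewrite mem_shuf //; apply/mapP/idP => [[t]|].
  rewrite mem_pmap_sub mem_filter mem_permutations => /andP[/andP[sp sq] pt] ->.
  exact/and3P.
case/and3P=> pw sp sq.
have wP : uniq w && all (ltn 0) w.
  rewrite (perm_uniq pw) upq (perm_all _ pw) all_cat.
  by have /andP[_ ->] := wordP p; have /andP[_ ->] := wordP q.
exists (Permutation wP) => //.
by rewrite mem_pmap_sub mem_filter mem_permutations /= sp sq.
Qed.

(** * Finite sums and finite supports *)

Lemma big_pick (V : nmodType) (I : eqType) (s : seq I) (x : I) (F : I -> V) :
  uniq s -> (x \notin s -> F x = 0) -> \sum_(i <- s) F i *+ (x == i) = F x.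
Proof.
move=> us; have [xs _|xs ->//] := boolP (x \in s).
  rewrite (bigD1_seq x) //= eqxx mulr1n big1_seq ?addr0 // => i /andP[ix _].
  by rewrite eq_sym (negPf ix) mulr0n.
by rewrite big1_seq // => i /= si; case: eqP xs => // ->; rewrite si.
Qed.

Lemma big_indicator (I : Type) (s : seq I) (P : pred I) :
  \sum_(i <- s) (P i)%:R = (count P s)%:R :> rat.
Proof. by elim: s => [|i s IH]; rewrite ?big_nil // big_cons IH -natrD. Qed.

Lemma fsbig_support (I : choiceType) (V : nmodType) (A : set I) (F : I -> V) :
  finite_set A -> (forall i, ~ A i -> F i = 0) ->
  \sum_(i \in [set: I]) F i = \sum_(i <- fset_set A) F i.
Proof.
move=> fA F0; rewrite -(fsbig_widen A) ?fsbig_finite //.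
by move=> i [_ /F0].
Qed.

(** A composition is recovered from its canonical permutation, a rearrangement of 1, ..., k with [k]
    at most [n]. *)
Lemma finite_comp_le n : finite_set [set L : composition | (sumn L <= n)%N].
Proof.
pose ps : seq permutation := pmap insub (flatten
  [seq permutations (iota 1 k) | k <- iota 0 n.+1]).
have fin : finite_set [set` ps] by exact: finite_seq.
apply: (sub_finite_set _ (finite_image descent_comp fin)) => L /= Ln.
exists (canon_perm L); last exact: canon_permK.
rewrite /= mem_pmap_sub; apply/flatten_mapP; exists (sumn L).
  by rewrite mem_iota.
rewrite mem_permutations uniq_perm ?iota_uniq //.
  by have /andP[] := canon_wordP L.
by move=> x; rewrite mem_canon_word mem_iota add1n ltnS.
Qed.

Lemma size_canon_word (L : composition) : size (canon_word L) = sumn L.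
Proof. by rewrite -[LHS](sumn_descent_comp (canon_perm L)) canon_permK. Qed.

(** * Class sums of ribbons and their coproducts *)

Section Classes.
Variables (T : eqType) (st : permutation -> T).
Hypothesis hst : descent_statistic st.

(** Series are evaluated at words with possible repetitions, so classes are extended from
    permutations to all words. *)
Definition word_class (w : seq nat) : comp_class st :=
  \pi_(comp_class st) (weak_comp w).

Lemma word_class_canon (b : comp_class st) : word_class (canon_word (repr b)) = b.
Proof. by rewrite /word_class weak_compK reprK. Qed.

Lemma word_class_perm (p : permutation) :
  word_class p = \pi_(comp_class st) (descent_comp p).
Proof. by rewrite /word_class weak_comp_perm. Qed.

Lemma word_class_eq (t : permutation) (a : comp_class st) :
  (word_class t == a) = (size t == sumn (repr a)) && (st t == st_comp st (repr a)).
Proof.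
by rewrite word_class_perm -[in LHS](reprK a) eqquotE /= /comp_eqv
  sumn_descent_comp st_compE.
Qed.

Lemma ribbon_stE (a : comp_class st) w : ribbon_st a w = (word_class w == a)%:R.
Proof.
rewrite /ribbon_st fsbig_finite; last exact: finite_comp_class.
rewrite fct_sumE.
under eq_bigr => L _.
  rewrite ribbonE -[weak_seq w]/(val (weak_comp w)) (inj_eq val_inj) eq_sym.
  over.
rewrite (big_indicator _ (pred1 (weak_comp w))) count_uniq_mem ?fset_uniq //.
rewrite in_fset_set; last exact: finite_comp_class.
by congr (nat_of_bool _)%:R; apply/idP/eqP => [/set_mem|/mem_set].
Qed.

Lemma NSym_ribbon_st (a : comp_class st) : NSym (ribbon_st a).
Proof.
rewrite /ribbon_st fsbig_finite; last exact: finite_comp_class.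
under eq_bigr do rewrite -[ribbon _]scale1r.
by apply: lin_span_sum => L _; exact: NSym_ribbon.
Qed.

Lemma comult_ribbon_st (a : comp_class st) p q : disjoint_perm p q ->
  comult (ribbon_st a) p q =
  (count (fun t : permutation => word_class t == a) (shuffles p q))%:R.
Proof.
move=> dpq; rewrite comult_disjoint; last 2 first.
- exact: NSym_ribbon_st.
- by rewrite has_sym.
rewrite -(perm_big _ (perm_shuffles dpq)) big_map -big_indicator.
by apply: eq_bigr => t _; rewrite ribbon_stE.
Qed.

(** All shuffles have the same length, so only the value of [st] remains to be counted once the
    lengths match. *)
Lemma count_shuffles_class (a : comp_class st) p q : disjoint_perm p q ->
  count (fun t : permutation => word_class t == a) (shuffles p q) =
  (((size p + size q)%N == sumn (repr a)) *
     count_mem (st_comp st (repr a)) [seq st t | t <- shuffles p q])%N.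
Proof.
move=> dpq; rewrite count_map.
have e : {in shuffles p q, (fun t : permutation => word_class t == a) =1
    (fun t => ((size p + size q)%N == sumn (repr a)) &&
              (st t == st_comp st (repr a)))}.
  by move=> t; rewrite mem_shuffles // word_class_eq => /and3P[/eqP->].
rewrite (eq_in_count e); case: (_ == sumn _) => /=; last exact: count_pred0.
by rewrite mul1n.
Qed.

(** By [comult_eval], arbitrary words may be replaced by disjoint permutations with the same
    runs. *)
Lemma comult_ribbon_st_canon (a : comp_class st) u v :
  let p := canon_perm (weak_comp u) in
  let q := shift_perm (sumn p) (canon_perm (weak_comp v)) in
  comult (ribbon_st a) u v =
  (count (fun t : permutation => word_class t == a) (shuffles p q))%:R.
Proof.
move=> p q; rewrite -comult_ribbon_st; last exact: disjoint_shift.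
apply: comult_eval; first exact: NSym_ribbon_st.
  exact/esym/(congr1 val (weak_compK _)).
have := weak_comp_perm q.
by rewrite descent_comp_shift canon_permK => /(congr1 val).
Qed.

(** Class sums are indicators of word classes, so evaluation at [(u, v)] isolates a single term; in
    particular the coproduct determines [c]. *)
Lemma comult_expansionP (a : comp_class st) c :
  comult_expansion a c <->
  finite_set [set bg | c bg.1 bg.2 != 0] /\
  forall u v, comult (ribbon_st a) u v = c (word_class u) (word_class v).
Proof.
pose A := [set bg | c bg.1 bg.2 != 0].
suff sumE : finite_set A -> forall u v,
    (\sum_(bg \in [set: comp_class st * comp_class st])
      c bg.1 bg.2 *: tens (ribbon_st bg.1) (ribbon_st bg.2)) u v =
    c (word_class u) (word_class v).
  split=> [[fA e]|[fA e]]; split=> //; first by move=> u v; rewrite e sumE.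
  by apply/funext => u; apply/funext => v; rewrite e sumE.
move=> fA u v; rewrite (fsbig_support fA); last first.
  by move=> bg /negP; rewrite negbK => /eqP ->; rewrite scale0r.
rewrite fct_sum2E.
rewrite -[RHS](@big_pick _ _ (fset_set A) (word_class u, word_class v)
  (fun bg => c bg.1 bg.2)) ?fset_uniq //; last first.
  rewrite in_fset_set // => /negP xA; apply/eqP/contraT => cx.
  by case: xA; exact: mem_set.
apply: eq_bigr => -[b g] _; rewrite -[LHS]/(_ * (_ * _)) !ribbon_stE.
by rewrite -natrM mulnb mulr_natr.
Qed.

Lemma comult_expansion_exists (a : comp_class st) :
  (forall u u' v v', word_class u = word_class u' -> word_class v = word_class v' ->
    comult (ribbon_st a) u v = comult (ribbon_st a) u' v') ->
  exists c, comult_expansion a c.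
Proof.
move=> h; exists (fun b g : comp_class st =>
  comult (ribbon_st a) (canon_word (repr b)) (canon_word (repr g))).
apply/comult_expansionP; split; last first.
  by move=> u v; apply: h; rewrite word_class_canon.
(* A nonzero coefficient yields a shuffle in the class [a], so the sizes of [b] and [g] add up to
   that of [a]. *)
have fin := finite_image (fun L : composition => \pi_(comp_class st) L)
  (finite_comp_le (sumn (repr a))).
apply: sub_finite_set (finite_setX fin fin) => -[b g] /=.
rewrite comult_ribbon_st_canon !weak_compK pnatr_eq0 -lt0n -has_count.
case/hasP=> t; rewrite mem_shuffles; last exact: disjoint_shift.
case/and3P=> /eqP st_ _ _; rewrite word_class_eq => /andP[/eqP ta _].
move: st_; rewrite ta size_map !size_canon_word => sa.
by split; [exists (repr b)|exists (repr g)];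
  rewrite ?reprK //= sa ?leq_addr ?leq_addl.
Qed.

(** * Shuffle-compatibility, subcoalgebras and structure constants *)

Lemma word_class_st (p p' : permutation) : word_class p = word_class p' <->
  size p = size p' /\ st p = st p'.
Proof.
rewrite !word_class_perm; split=> [/eqquotP/andP[]|[e1 e2]].
  by rewrite !sumn_descent_comp !st_compE // => /eqP-> /eqP->.
by apply/eqquotP/andP; rewrite !sumn_descent_comp !st_compE // e1 e2.
Qed.

Lemma shuffle_compatible_comult : shuffle_compatible st <->
  forall a : comp_class st, exists c, comult_expansion a c.
Proof.
split=> [sc a|ex p q p' q' dpq dpq' sp sq tp tq].
  apply: comult_expansion_exists => u u' v v' uu' vv'.
  rewrite !comult_ribbon_st_canon.
  rewrite !count_shuffles_class; try exact: disjoint_shift.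
  set p := canon_perm _; set q := shift_perm _ _.
  set p' := canon_perm (weak_comp u').
  set q' := shift_perm _ (canon_perm (weak_comp v')).
  have /word_class_st[sp tp] : word_class p = word_class p'.
    by rewrite !word_class_perm !canon_permK.
  have /word_class_st[sq tq] : word_class q = word_class q'.
    by rewrite !word_class_perm !descent_comp_shift !canon_permK.
  have /permP pe :=
    sc p q p' q' (disjoint_shift _ _) (disjoint_shift _ _) sp sq tp tq.
  by rewrite sp sq pe.
have key a : count (fun t : permutation => word_class t == a) (shuffles p q) =
    count (fun t : permutation => word_class t == a) (shuffles p' q').
  have [c /comult_expansionP[_ ce]] := ex a.
  apply/eqP; rewrite -(eqr_nat rat) -!comult_ribbon_st // !ce.
  by have [_ ->//] := word_class_st p p'; have [_ ->//] := word_class_st q q'.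
(* [perm_eq] only compares multiplicities of values that occur. For a shuffle [t] with value [x],
   the count of the class of [t] in [key] is the multiplicity of [x], all shuffles having the length
   of [t]. *)
apply/allP => x; rewrite mem_cat => xin /=.
have [t tn <-] : exists2 t : permutation, size t = (size p + size q)%N & st t = x.
  case/orP: xin => /mapP[t]; rewrite mem_shuffles // => /and3P[/eqP tn _ _] ->.
    by exists t.
  by exists t; rewrite // sp sq.
have := key (word_class t); rewrite !count_shuffles_class //.
have := eqxx (word_class t); rewrite word_class_eq => /andP[/eqP <- /eqP <-].
by rewrite -sp -sq tn eqxx !mul1n => ->.
Qed.

Lemma subcoalgebra_comult :
  (forall a : comp_class st, exists c, comult_expansion a c) <->
  subcoalgebra (lin_span [set ribbon_st a | a in [set: comp_class st]]).
Proof.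
set C := lin_span _.
have rC (a : comp_class st) : C (ribbon_st a) by apply: lin_span_mem; exists a.
split=> [ex|[_ _ coC] a]; last first.
  (* Elements of [C] are constant on word classes, so tensors over [C] are constant on pairs of
     classes. *)
  apply: comult_expansion_exists => u u' v v' uu' vv'.
  apply: tensor_space_eval (coC _ (rC a)) => f; apply: lin_span_eval => _ [b _ <-].
    by rewrite !ribbon_stE uu'.
  by rewrite !ribbon_stE vv'.
split.
- apply/seteqP; split=> [f [s [sP ->]]|f]; last exact: lin_span_mem.
  by apply: lin_span_sum => cv /sP.
- move=> f [s [sP ->]]; apply: lin_span_sum => cv /sP[a _ <-].
  exact: NSym_ribbon_st.
move=> f [s [sP ->]]; rewrite comult_sum; last first.
  by move=> cv /sP[a _ <-]; exact: NSym_ribbon_st.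
apply: lin_span_sum => cv /sP[a _ <-]; have [c [fc ->]] := ex a.
rewrite (fsbig_support fc); last first.
  by move=> bg /negP; rewrite negbK => /eqP ->; rewrite scale0r.
apply: lin_span_sum => bg _; apply: lin_span_mem.
by exists (ribbon_st bg.1), (ribbon_st bg.2); split.
Qed.

Lemma shuffle_mul_comult
    (c : comp_class st -> comp_class st -> comp_class st -> rat) :
  shuffle_compatible st -> (forall a, comult_expansion a (c a)) ->
  forall b g : comp_class st,
    finite_set [set a | c a b g != 0] /\
    shuffle_mul (class_vec b) (class_vec g) =
      \sum_(a \in [set: comp_class st]) c a b g *: class_vec a.
Proof.
move=> sc ce b g; pose p := canon_perm (repr b).
pose q := shift_perm (sumn p) (canon_perm (repr g)).
have dpq : disjoint_perm p q by exact: disjoint_shift.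
pose A : set (comp_class st) :=
  [set` [seq word_class t | t : permutation <- shuffles p q]].
(* The expansion is evaluated at the disjoint representatives [p] and [q], which forces the
   coefficients to be shuffle counts. *)
have cE a : c a b g =
    (count (fun t : permutation => word_class t == a) (shuffles p q))%:R.
  have /comult_expansionP[_ ca] := ce a.
  rewrite -comult_ribbon_st // ca !word_class_perm descent_comp_shift.
  by rewrite !canon_permK !reprK.
have fA : finite_set A by exact: finite_seq.
have c0 a : ~ A a -> c a b g = 0.
  move=> Aa; rewrite cE; apply/eqP; rewrite pnatr_eq0 -leqn0 leqNgt -has_count.
  by apply/hasPn => t tpq; apply/eqP => ta; apply: Aa; apply/mapP; exists t.
split.
  apply: sub_finite_set fA => a /= ca; apply: contrapT => /c0 e.
  by rewrite e eqxx in ca.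
have -> : class_vec b = perm_vec st p by [].
have -> : class_vec g = perm_vec st q.
  rewrite /class_vec /perm_vec; congr << _ >>; apply/esym/eqP.
  by rewrite perm_class_ofE // descent_comp_shift canon_permK reprK.
rewrite shuffle_mulE // (fsbig_support fA); last first.
  by move=> a /c0 ->; rewrite scale0r.
(* Each count becomes a sum of indicators over shuffles; after exchanging the sums, every shuffle
   selects its own class. *)
under [RHS]eq_bigr do rewrite cE -big_indicator scaler_suml.
rewrite exchange_big /= big_seq [RHS]big_seq; apply: eq_bigr => t tpq.
under eq_bigr do rewrite scaler_nat.
rewrite big_pick ?fset_uniq //.
  rewrite /class_vec /perm_vec; congr << _ >>; apply/eqP.
  by rewrite perm_class_ofE // word_class_perm.
by rewrite in_fset_set // mem_set //; apply/mapP; exists t.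
Qed.

End Classes.

Theorem theorem5p6 (T : eqType) (st : permutation -> T)
    (hst : descent_statistic st) :
  [/\ shuffle_compatible st <->
        (forall a : comp_class st,
           exists c : comp_class st -> comp_class st -> rat,
             comult_expansion a c),
      (forall a : comp_class st,
         exists c : comp_class st -> comp_class st -> rat,
           comult_expansion a c) <->
        subcoalgebra (lin_span [set ribbon_st a | a in [set: comp_class st]])
    & shuffle_compatible st ->
      forall c : comp_class st -> comp_class st -> comp_class st -> rat,
        (forall a : comp_class st, comult_expansion a (c a)) ->
        forall b g : comp_class st,
          finite_set [set a | c a b g != 0] /\
          shuffle_mul (class_vec b) (class_vec g) =
            \sum_(a \in [set: comp_class st]) c a b g *: class_vec a].
Proof.
split; first exact: shuffle_compatible_comult.
  exact: subcoalgebra_comult.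
by move=> sc c ce; exact: shuffle_mul_comult.
Qed.
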